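(* Let $(A,\mu,\alpha)$ be a Hom-associative algebra. Then $$A_L=(A,[,,],\alpha^2)$$ (with both twisting maps equal to $\alpha^2=\alpha\circ\alpha$) is a Hom-Lie triple system, where, writing $\mu(x,y)$ as $xy$, $$[xyz]=(xy)\alpha(z)-(yx)\alpha(z)-(zx)\alpha(y)+(zy)\alpha(x)$$ for $x,y,z\in A$. Moreover, if $A$ is multiplicative, then so is $A_L$.
   Context: We work over a fixed field $\mathbf{k}$ of characteristic $0$. A Hom-associative algebra $(A,\mu,\alpha)$ is a $\mathbf{k}$-module $A$ with a bilinear map $\mu\colon A^{\otimes 2}\to A$ and a linear map $\alpha\colon A\to A$ such that $(xy)\alpha(z)=\alpha(x)(yz)$ for all $x,y,z\in A$. It is multiplicative if $\alpha(xy)=\alpha(x)\alpha(y)$ for all $x,y$. A Hom-Lie triple system $(V,[,,],(\alpha_1,\alpha_2))$ is a $\mathbf{k}$-module $V$ with a trilinear map $[,,]\colon V^{\otimes 3}\to V$ and linear maps $\alpha_1,\alpha_2\colon V\to V$ (twisting maps) such that $[uvw]=-[vuw]$, $[uvw]+[wuv]+[vwu]=0$, and $$[\alpha_1(x)\alpha_2(y)[uvw]]=[[xyu]\alpha_1(v)\alpha_2(w)]+[\alpha_1(u)[xyv]\alpha_2(w)]+[\alpha_1(u)\alpha_2(v)[xyw]]$$ for all $u,v,w,x,y\in V$. It is multiplicative if $\alpha_1=\alpha_2$ and this common map $\gamma$ satisfies $\gamma([xyz])=[\gamma(x)\gamma(y)\gamma(z)]$ for all $x,y,z$. When the twisting maps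 are equal only the common value is written. *)

(* Defs.v *)
From HB Require Import structures.
From mathcomp Require Import all_boot all_order all_algebra.

Set Implicit Arguments.
Unset Strict Implicit.
Unset Printing Implicit Defensive.

Import GRing.Theory.
Local Open Scope ring_scope.

Definition hom_associative (k : fieldType) (A : lmodType k)
    (mu : {bilinear A -> A -> A}) (alpha : {linear A -> A}) : Prop :=
  forall x y z : A, mu (mu x y) (alpha z) = mu (alpha x) (mu y z).

Definition hom_assoc_multiplicative (k : fieldType) (A : lmodType k)
    (mu : {bilinear A -> A -> A}) (alpha : {linear A -> A}) : Prop :=
  forall x y : A, alpha (mu x y) = mu (alpha x) (alpha y).

Definition trilinear (k : fieldType) (V : lmodType k)
    (t : V -> V -> V -> V) : Prop :=
  [/\ forall y z, linear (fun x => t x y z),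
      forall x z, linear (fun y => t x y z)
    & forall x y, linear (fun z => t x y z)].

Record hom_lie_triple_system (k : fieldType) (V : lmodType k)
    (t : V -> V -> V -> V) (alpha1 alpha2 : V -> V) : Prop :=
  HomLieTripleSystem {
    hlts_trilinear : trilinear t;
    hlts_linear1 : linear alpha1;
    hlts_linear2 : linear alpha2;
    hlts_antisym : forall u v w, t u v w = - t v u w;
    hlts_cyclic : forall u v w, t u v w + t w u v + t v w u = 0;
    hlts_nambu : forall u v w x y,
      t (alpha1 x) (alpha2 y) (t u v w) =
        t (t x y u) (alpha1 v) (alpha2 w)
        + t (alpha1 u) (t x y v) (alpha2 w)
        + t (alpha1 u) (alpha2 v) (t x y w)
  }.

Definition hlts_multiplicative (k : fieldType) (V : lmodType k)
    (t : V -> V -> V -> V) (alpha1 alpha2 : V -> V) : Prop :=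
  alpha1 =1 alpha2
  /\ forall x y z, alpha1 (t x y z) = t (alpha1 x) (alpha1 y) (alpha1 z).

Definition hom_assoc_bracket (k : fieldType) (A : lmodType k)
    (mu : {bilinear A -> A -> A}) (alpha : {linear A -> A}) (x y z : A) : A :=
  mu (mu x y) (alpha z) - mu (mu y x) (alpha z)
  - mu (mu z x) (alpha y) + mu (mu z y) (alpha x).

(* Main.v *)
Require Import Defs.
From HB Require Import structures.
From mathcomp Require Import all_boot all_order all_algebra.

Import GRing.Theory.
Local Open Scope ring_scope.

(** The bracket is an alternating sum of the triple product
    [P a b c = (ab) alpha(c)]. By Hom-associativity, inserting [P] into any of the
    three slots of [P], with [alpha^2] applied to the other two arguments, gives
    the same left-normed product of five factors. Hence the operators [[x y -]]
    act on [P] as twisted derivations, by telescoping, and therefore on the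
    bracket, which is a combination of permuted copies of [P]. *)

Lemma subrACA (V : zmodType) (a b c d : V) :
  (a + b) - (c + d) = (a - c) + (b - d).
Proof. by rewrite opprD addrACA. Qed.

Lemma subrACA3 (V : zmodType) (a b c a' b' c' : V) :
  (a + b + c) - (a' + b' + c') = (a - a') + (b - b') + (c - c').
Proof. by rewrite !subrACA. Qed.

Section HomAssociative.

Context {k : fieldType} {A : lmodType k}.
Variables (mu : {bilinear A -> A -> A}) (alpha : {linear A -> A}).

Definition hom_triple_product (a b c : A) : A := mu (mu a b) (alpha c).

Local Notation P := hom_triple_product.
Local Notation br := (hom_assoc_bracket mu alpha).
Local Notation alpha2 := (alpha \o alpha).

Lemma hom_triple_product_linear1 b c : linear (fun a => P a b c).
Proof. by move=> s x y; rewrite /P linearPl linearPl. Qed.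

Lemma hom_triple_product_linear2 a c : linear (fun b => P a b c).
Proof. by move=> s x y; rewrite /P linearPr linearPl. Qed.

Lemma hom_triple_product_linear3 a b : linear (fun c => P a b c).
Proof. by move=> s x y; rewrite /P linearP linearPr. Qed.

Lemma hom_triple_productB1 b c : {morph (fun a => P a b c) : x y / x - y}.
Proof. by move=> x y; rewrite /P !linearBl. Qed.

Lemma hom_triple_productB2 a c : {morph (fun b => P a b c) : x y / x - y}.
Proof. by move=> x y; rewrite /P linearBr linearBl. Qed.

Lemma hom_triple_productB3 a b : {morph (fun c => P a b c) : x y / x - y}.
Proof. by move=> x y; rewrite /P linearB linearBr. Qed.

(** Grouped as a difference of two commutators in [x] and [y], the shape in which adjacent terms
    cancel by [subrKA]. *)
Lemma hom_assoc_bracketE x y z :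
  br x y z = (P x y z - P y x z) - (P z x y - P z y x).
Proof. by rewrite opprB addrA [RHS]addrAC. Qed.

Lemma hom_assoc_bracket_trilinear : trilinear br.
Proof.
have comb (s : k) (a b c d a' b' c' d' : A) :
  (s *: a + a') - (s *: b + b') - ((s *: c + c') - (s *: d + d'))
  = s *: (a - b - (c - d)) + (a' - b' - (c' - d')).
  by rewrite !scalerBr [X in X - _]subrACA [X in _ - X]subrACA subrACA.
by split=> y z s x x'; rewrite !hom_assoc_bracketE
  !(hom_triple_product_linear1, hom_triple_product_linear2,
    hom_triple_product_linear3) comb.
Qed.

Lemma hom_assoc_bracket_antisym u v w : br u v w = - br v u w.
Proof. by rewrite !hom_assoc_bracketE !opprB addrC. Qed.

Lemma hom_assoc_bracket_cyclic u v w : br u v w + br w u v + br v w u = 0.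
Proof.
(* The even and the odd permutations are paired off separately; each pair of terms is a difference
   that telescopes around the cycle. *)
have brE x y z : br x y z = (P x y z - P z x y) + (P z y x - P y x z).
  by rewrite hom_assoc_bracketE opprB addrACA [X in _ + X]addrC addrACA.
by rewrite !brE [X in X + _]addrACA !subrKA addrACA !subrKA !subrr addr0.
Qed.

Hypothesis homA : hom_associative mu alpha.

(** In the left factor, α²(a)((bc)α(d)) = (α(a)(bc))α²(d) = ((ab)α(c))α²(d). *)
Lemma hom_triple_product_insert2 a b c d e :
  P (alpha2 a) (P b c d) (alpha2 e) = P (P a b c) (alpha2 d) (alpha2 e).
Proof. by rewrite /P /= -!homA. Qed.

Lemma hom_triple_product_insert3 a b c d e :
  P (alpha2 a) (alpha2 b) (P c d e) = P (P a b c) (alpha2 d) (alpha2 e).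
Proof.
(* Both sides become α³(a) times a factor: α²(b)((cd)α(e)) on the left and ((bc)α(d))α²(e) on the
   right, equal by two more uses of [homA]. *)
rewrite -hom_triple_product_insert2 /P /= homA [RHS]homA.
by rewrite -[mu (alpha (alpha b)) _]homA -[mu (alpha b) _]homA.
Qed.

Lemma hom_triple_product_derivation x y u v w :
  br (alpha2 x) (alpha2 y) (P u v w) =
    P (br x y u) (alpha2 v) (alpha2 w) + P (alpha2 u) (br x y v) (alpha2 w)
    + P (alpha2 u) (alpha2 v) (br x y w).
Proof.
rewrite !hom_assoc_bracketE !(hom_triple_productB1, hom_triple_productB2,
  hom_triple_productB3) !(hom_triple_product_insert2,
  hom_triple_product_insert3).
(* In five-letter words, the commutator of [x] and [y] moves rightwards through [u], [v], [w]: each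
   summand is its value before a letter minus its value after, so only the two ends remain. *)
by rewrite !subrKA.
Qed.

Lemma hom_assoc_bracket_nambu u v w x y :
  br (alpha2 x) (alpha2 y) (br u v w) =
    br (br x y u) (alpha2 v) (alpha2 w) + br (alpha2 u) (br x y v) (alpha2 w)
    + br (alpha2 u) (alpha2 v) (br x y w).
Proof.
have [_ _ brlin] := hom_assoc_bracket_trilinear.
have brB a b : {morph br a b : c d / c - d}.
  by move=> c d; rewrite addrC -scaleN1r brlin scaleN1r addrC.
rewrite [br u v w]hom_assoc_bracketE !brB !hom_triple_product_derivation.
rewrite [br (br x y u) _ _]hom_assoc_bracketE
  [br _ (br x y v) _]hom_assoc_bracketE [br _ _ (br x y w)]hom_assoc_bracketE.
(* Each expansion lists its terms by slot. They are reordered by the letter acted on, [u], [v], [w],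
   so that the alternating sum splits into the three brackets. *)
rewrite [P (br x y v) _ _ + _]addrC -[X in _ - (X - _)]addrA
  [X in _ - (X - _)]addrC [X in _ - (_ - X)]addrC [X in _ - (_ - (_ + X))]addrC.
by rewrite [X in _ - (_ - X)]addrA [X in X - _]subrACA3
  [X in _ - X]subrACA3 subrACA3.
Qed.

End HomAssociative.

Theorem corollary4p8 (k : fieldType) (char_k0 : [pchar k] =i pred0)
    (A : lmodType k) (mu : {bilinear A -> A -> A}) (alpha : {linear A -> A})
    (homA : hom_associative mu alpha) :
  hom_lie_triple_system (hom_assoc_bracket mu alpha)
    (alpha \o alpha) (alpha \o alpha)
  /\ (hom_assoc_multiplicative mu alpha ->
      hlts_multiplicative (hom_assoc_bracket mu alpha)
        (alpha \o alpha) (alpha \o alpha)).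
Proof.
split.
  split; [exact: hom_assoc_bracket_trilinear | exact: linearP | exact: linearP
    | exact: hom_assoc_bracket_antisym | exact: hom_assoc_bracket_cyclic
    | exact: hom_assoc_bracket_nambu].
move=> alphaM; split=> // x y z.
by rewrite /hom_assoc_bracket /= !(raddfB, raddfD) /= !alphaM.
Qed.
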